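(* Any weighted projective space arises as the orbit space of any other of the same dimension, under the action of a finite abelian group. That is, for any two vectors $\chi=(\chi_0,\dots,\chi_n)$ and $\omega=(\omega_0,\dots,\omega_n)$ of positive integers, there is an action of a finite abelian group on $\mathbb{P}(\omega)$ whose orbit space is homeomorphic to $\mathbb{P}(\chi)$.
   Context: For a vector $\chi=(\chi_0,\dots,\chi_n)$ of positive integers, the weighted projective space $\mathbb{P}(\chi)$ is the orbit space of the unit sphere $S^{2n+1}\subset\mathbb{C}^{n+1}$ under the action $t\cdot(z_0,\dots,z_n)=(t^{\chi_0}z_0,\dots,t^{\chi_n}z_n)$ of the group $T$ of unimodular complex numbers. Group actions are continuous. *)

(* Defs.v *)
From HB Require Import structures.
From mathcomp Require Import all_boot all_order all_algebra all_fingroup.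
From mathcomp Require Import all_classical all_reals all_analysis complex.

Set Implicit Arguments.
Unset Strict Implicit.
Unset Printing Implicit Defensive.

Import Order.TTheory GRing.Theory Num.Theory.
Import numFieldNormedType.Exports.

Local Open Scope classical_set_scope.
Local Open Scope quotient_scope.
Local Open Scope ring_scope.

Definition homeomorphic (X Y : topologicalType) : Prop :=
  exists (f : X -> Y) (g : Y -> X),
    [/\ continuous f, continuous g, cancel f g & cancel g f].

HB.mixin Record Group_isTopologicalGroup G & monoid.Group G & Topological G := {
  mulg_continuous : continuous (fun p : G * G => (p.1 * p.2)%g);
  invg_continuous : continuous (fun g : G => g^-1%g)
}.

#[short(type="topologicalGroupType")]
HB.structure Definition TopologicalGroup :=
  { G of monoid.Group G & Topological G & Group_isTopologicalGroup G }.

Record continuous_action (G : topologicalGroupType) (X : topologicalType) :=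
  ContinuousAction {
    caction :> G -> X -> X;
    caction1 : forall x, caction 1%g x = x;
    cactionM : forall g h x, caction (g * h)%g x = caction g (caction h x);
    caction_continuous : continuous (fun p : G * X => caction p.1 p.2)
  }.

Section OrbitSpace.
Context {G : topologicalGroupType} {X : topologicalType}.
Variable a : continuous_action G X.

Definition same_orbit (x y : X) : bool := `[< exists g : G, a g x = y >].

Lemma same_orbit_refl : reflexive same_orbit.
Proof. by move=> x; apply/asboolP; exists 1%g; rewrite caction1. Qed.

Lemma same_orbit_sym : symmetric same_orbit.
Proof.
suff H x y : same_orbit x y -> same_orbit y x.
  by move=> x y; apply/idP/idP; exact: H.
move=> /asboolP[g <-]; apply/asboolP; exists g^-1%g.
by rewrite -cactionM mulVg caction1.
Qed.

Lemma same_orbit_trans : transitive same_orbit.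
Proof.
move=> y x z /asboolP[g <-] /asboolP[h <-]; apply/asboolP.
by exists (h * g)%g; rewrite cactionM.
Qed.

Canonical same_orbit_equiv :=
  EquivRel same_orbit same_orbit_refl same_orbit_sym same_orbit_trans.

(* The quotient topology along X -> X/G. *)
Definition orbit_space : topologicalType :=
  quotient_topology {eq_quot same_orbit_equiv}.

End OrbitSpace.

(* An action of an abstract finite group A is a continuous action of
   discrete_topology A. *)
Section DiscreteGroup.
Variable G : groupType.

HB.instance Definition _ := monoid.Group.copy (discrete_topology G) G.

Let mulg_cts :
  continuous (fun p : discrete_topology G * discrete_topology G =>
    (p.1 * p.2 : discrete_topology G)%g).
Proof.
move=> [x y] U /= /principal_filterP Uxy.
exists ([set x], [set y]); first by split; exact/principal_filterP.
by move=> [u v] [/= -> ->].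
Qed.

Let invg_cts : continuous (fun g : discrete_topology G =>
  (g^-1 : discrete_topology G)%g).
Proof. by move=> x U /= /principal_filterP Ux; exact/principal_filterP. Qed.

HB.instance Definition _ :=
  Group_isTopologicalGroup.Build (discrete_topology G) mulg_cts invg_cts.

End DiscreteGroup.

(* Everything below is stated over an abstract numClosedFieldType with its norm
   topology, which is easier to manipulate than the record type R[i]; the
   intended instance is C := R[i] for R : realType. *)
Section Circle.
Variable C : numClosedFieldType.

Definition unit_circle : set C := [set t | `|t| = 1].

Definition circle : Type := unit_circle.
HB.instance Definition _ := Topological.copy circle (set_type unit_circle).

Definition circle_val (t : circle) : C := \val t.

Lemma circle_val_inj : injective circle_val.
Proof. exact: val_inj. Qed.

Lemma norm_circle_val (t : circle) : `|circle_val t| = 1.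
Proof. exact: set_valP t. Qed.

Lemma circle_val_continuous : continuous circle_val.
Proof. exact: initial_continuous. Qed.

Definition Circle (t : C) (t1 : unit_circle t) : circle := exist _ t (mem_set t1).

Lemma to_circle_continuous (X : topologicalType) (f : X -> circle) :
  continuous (circle_val \o f) -> continuous f.
Proof. by move=> cf; apply/continuous_comp_initial. Qed.

Let one_subproof : unit_circle 1.
Proof. exact: normr1. Qed.

Let mul_subproof (s t : circle) : unit_circle (circle_val s * circle_val t).
Proof. by rewrite /unit_circle /= normrM !norm_circle_val mulr1. Qed.

Let inv_subproof (t : circle) : unit_circle (circle_val t)^-1.
Proof. by rewrite /unit_circle /= normfV norm_circle_val invr1. Qed.

Definition circle_one : circle := Circle one_subproof.
Definition circle_mul s t : circle := Circle (mul_subproof s t).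
Definition circle_inv t : circle := Circle (inv_subproof t).

Let circle_val_neq0 t : circle_val t != 0.
Proof. by rewrite -normr_eq0 norm_circle_val oner_eq0. Qed.

Let mulA : associative circle_mul.
Proof. by move=> s t u; apply: circle_val_inj; rewrite /circle_val/= mulrA. Qed.
Let mul1 : left_id circle_one circle_mul.
Proof. by move=> s; apply: circle_val_inj; rewrite /circle_val/= mul1r. Qed.
Let mul1' : right_id circle_one circle_mul.
Proof. by move=> s; apply: circle_val_inj; rewrite /circle_val/= mulr1. Qed.
Let mulV : left_inverse circle_one circle_inv circle_mul.
Proof. by move=> s; apply: circle_val_inj; exact: mulVf. Qed.
Let mulV' : right_inverse circle_one circle_inv circle_mul.
Proof. by move=> s; apply: circle_val_inj; exact: mulfV. Qed.

HB.instance Definition _ := monoid.isGroup.Build circle mulA mul1 mul1' mulV mulV'.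

Let mul_cts : continuous (fun p : circle * circle => (p.1 * p.2)%g).
Proof.
apply: to_circle_continuous => p.
apply: cvgM.
  by apply: (cvg_comp _ _ cvg_fst); exact: circle_val_continuous.
by apply: (cvg_comp _ _ cvg_snd); exact: circle_val_continuous.
Qed.

Let inv_cts : continuous (fun t : circle => t^-1%g).
Proof.
apply: to_circle_continuous => t.
exact: (cvg_comp _ _ (@circle_val_continuous t)
  (inv_continuous (circle_val_neq0 t))).
Qed.

HB.instance Definition _ := Group_isTopologicalGroup.Build circle mul_cts inv_cts.

End Circle.

Section WeightedProjectiveSpace.
Variables (C : numClosedFieldType) (n : nat).

Definition unit_sphere : set 'rV[C]_n.+1 :=
  [set z | \sum_i `|z 0 i| ^+ 2 = 1].

(* S^(2n+1), with the topology induced from C^(n+1). *)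
Definition sphere : Type := unit_sphere.
HB.instance Definition _ := Topological.copy sphere (set_type unit_sphere).

Definition sphere_val (z : sphere) : 'rV[C]_n.+1 := \val z.

Lemma sphere_val_inj : injective sphere_val.
Proof. exact: val_inj. Qed.

Lemma sphere_valP (z : sphere) : unit_sphere (sphere_val z).
Proof. exact: set_valP z. Qed.

Lemma sphere_val_continuous : continuous sphere_val.
Proof. exact: initial_continuous. Qed.

Definition Sphere (z : 'rV[C]_n.+1) (z1 : unit_sphere z) : sphere :=
  exist _ z (mem_set z1).

Lemma to_sphere_continuous (X : topologicalType) (f : X -> sphere) :
  continuous (sphere_val \o f) -> continuous f.
Proof. by move=> cf; apply/continuous_comp_initial. Qed.

Variable chi : 'I_n.+1 -> nat.

Definition weighted_scale (t : C) (z : 'rV[C]_n.+1) : 'rV[C]_n.+1 :=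
  \row_i (t ^+ chi i * z 0 i).

Let weighted_subproof (t : circle C) (z : sphere) :
  unit_sphere (weighted_scale (circle_val t) (sphere_val z)).
Proof.
rewrite /unit_sphere /= -[RHS](sphere_valP z); apply: eq_bigr => i _.
by rewrite mxE normrM normrX norm_circle_val expr1n mul1r.
Qed.

Definition weighted_act (t : circle C) (z : sphere) : sphere :=
  Sphere (weighted_subproof t z).

Let weighted_act1 z : weighted_act 1%g z = z.
Proof.
by apply: sphere_val_inj; apply/rowP => i; rewrite mxE expr1n mul1r.
Qed.

Let weighted_actM s t z :
  weighted_act (s * t)%g z = weighted_act s (weighted_act t z).
Proof.
by apply: sphere_val_inj; apply/rowP => i; rewrite !mxE exprMn mulrA.
Qed.

Let weighted_act_continuous :
  continuous (fun p : circle C * sphere => weighted_act p.1 p.2).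
Proof.
apply: to_sphere_continuous => p A [P Pp PA].
suff : \forall q \near p, forall i j,
    P i j (weighted_scale (circle_val q.1) (sphere_val q.2) i j).
  by apply: filterS => q Pq; exact: PA.
apply: (@filter_forall _ _ _ (nbhs p)) => i.
apply: (@filter_forall _ _ _ (nbhs p)) => j.
suff : (fun q : circle C * sphere =>
    weighted_scale (circle_val q.1) (sphere_val q.2) i j) @ p -->
  weighted_scale (circle_val p.1) (sphere_val p.2) i j by apply; exact: Pp.
under eq_fun do rewrite mxE; rewrite mxE.
have ct : circle_val q.1 @[q --> p] --> circle_val p.1.
  by apply: (cvg_comp _ _ cvg_fst); exact: circle_val_continuous.
have cz : sphere_val q.2 @[q --> p] --> sphere_val p.2.
  by apply: (cvg_comp _ _ cvg_snd); exact: sphere_val_continuous.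
have ctX k : circle_val q.1 ^+ k @[q --> p] --> circle_val p.1 ^+ k.
  elim: k => [|k IHk]; first exact: cvg_cst.
  by under eq_fun do rewrite exprS; rewrite exprS; apply: cvgM.
apply: cvgM; first exact: ctX.
exact: (cvg_comp _ _ cz (@coord_continuous _ _ _ _ _ _)).
Qed.

Definition weighted_action : continuous_action (circle C) sphere :=
  ContinuousAction weighted_act1 weighted_actM weighted_act_continuous.

Definition weighted_projective_space : topologicalType :=
  orbit_space weighted_action.

End WeightedProjectiveSpace.

(* Main.v *)
(* Put [N = \prod_i omega i] and [m i = N * chi i / omega i].  Raising the phase
   of the [i]-th coordinate to the power [m i], while keeping its modulus, maps
   the sphere onto itself and turns the [omega]-action of [t] into the
   [chi]-action of [t ^+ N].  Its fibres are the orbits of the product [A] of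
   the groups of [m i]-th roots of unity, which commutes with the
   [omega]-action, and [t |-> t ^+ N] is onto; hence the composites
     sphere -> P(omega) -> P(omega) / A   and   sphere -> sphere -> P(chi)
   identify the same points.  Both are quotient maps, because the phase map is
   open. *)
Require Import Defs.
From mathcomp Require Import all_boot all_order all_algebra all_fingroup.
From mathcomp Require Import all_classical all_reals all_analysis complex.
From mathcomp Require Import cyclic separable cyclotomic.

Set Implicit Arguments.
Unset Strict Implicit.
Unset Printing Implicit Defensive.

Import Order.TTheory GRing.Theory Num.Theory numFieldNormedType.Exports.

(** * Quotient maps with the same fibres *)

Section QuotientMaps.
Local Open Scope classical_set_scope.

Definition quotient_map (X Y : topologicalType) (p : X -> Y) : Prop :=
  (forall y, exists x, p x = y) /\
  (forall B : set Y, open (p @^-1` B) <-> open B).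

Lemma quotient_map_comp (X Y Z : topologicalType) (p : X -> Y) (q : Y -> Z) :
  quotient_map p -> quotient_map q -> quotient_map (q \o p).
Proof.
move=> [p_surj p_open] [q_surj q_open]; split=> [z|B].
  by have [y <-] := q_surj z; have [x <-] := p_surj y; exists x.
by rewrite -q_open -p_open.
Qed.

(** Arbitrary set-theoretic sections [s] and [r] suffice: [q \o s] is continuous because composing
    it with the quotient map [p] gives back [q], and symmetrically for [p \o r]. *)
Lemma quotient_map_homeomorphic (X Y Z : topologicalType)
    (p : X -> Y) (q : X -> Z) :
  quotient_map p -> quotient_map q ->
  (forall x x', p x = p x' <-> q x = q x') -> homeomorphic Y Z.
Proof.
move=> [p_surj p_open] [q_surj q_open] pq.
have [s sK] := choice p_surj; have [r rK] := choice q_surj.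
have qsp x : q (s (p x)) = q x by apply/pq; rewrite sK.
have prq x : p (r (q x)) = p x by apply/pq; rewrite rK.
exists (q \o s), (p \o r); split.
- apply/continuousP => B B_open; apply/p_open.
  rewrite (_ : _ @^-1` _ = q @^-1` B); first exact/q_open.
  by apply/seteqP; split=> x /=; rewrite qsp.
- apply/continuousP => B B_open; apply/q_open.
  rewrite (_ : _ @^-1` _ = p @^-1` B); first exact/p_open.
  by apply/seteqP; split=> x /=; rewrite prq.
- by move=> y /=; have [x <-] := p_surj y; rewrite qsp prq.
- by move=> z /=; have [x <-] := q_surj z; rewrite prq qsp.
Qed.

End QuotientMaps.

(** * Orbit projections, and actions induced on an orbit space *)

Section OrbitProjection.
Local Open Scope classical_set_scope.
Local Open Scope quotient_scope.
Context {G : topologicalGroupType} {X : topologicalType}.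
Variable a : continuous_action G X.

Definition orbit_proj (x : X) : orbit_space a :=
  \pi_({eq_quot same_orbit_equiv a}) x.

Definition orbit_repr (y : orbit_space a) : X :=
  generic_quotient.repr (y : {eq_quot same_orbit_equiv a}).

Lemma orbit_reprK : cancel orbit_repr orbit_proj.
Proof. by move=> y; exact: reprK. Qed.

Lemma orbit_projP (x y : X) :
  orbit_proj x = orbit_proj y <-> exists g : G, a g x = y.
Proof.
by split=> [/(@eqmodP _ (same_orbit_equiv a))/asboolP|xy] //;
  apply/(@eqmodP _ (same_orbit_equiv a))/asboolP.
Qed.

Lemma orbit_proj_quotient_map : quotient_map orbit_proj.
Proof. by split=> [y|//]; exists (orbit_repr y); rewrite orbit_reprK. Qed.

Lemma orbit_space_continuous (Z : topologicalType) (f : orbit_space a -> Z) :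
  continuous (f \o orbit_proj) -> continuous f.
Proof. by move=> cf; exact/quotient_continuous. Qed.

Lemma orbit_proj_continuous : continuous orbit_proj.
Proof.
by apply/continuousP => B; have [_ /(_ B)[]] := orbit_proj_quotient_map.
Qed.

Section CommutingAction.
Local Open Scope group_scope.
Variables (A : groupType) (b : A -> X -> X).
Hypothesis b1 : forall x, b 1 x = x.
Hypothesis bM : forall g h x, b (g * h) x = b g (b h x).
Hypothesis b_continuous : forall g, continuous (b g).
Hypothesis b_comm : forall g t x, b g (a t x) = a t (b g x).

Definition orbit_act (g : discrete_topology A) (y : orbit_space a) :
  orbit_space a := orbit_proj (b g (orbit_repr y)).

(** Independence of the chosen representative: two representatives differ by some [t] in [G], and
    [b g] commutes with [a t]. *)
Lemma orbit_act_proj g x : orbit_act g (orbit_proj x) = orbit_proj (b g x).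
Proof.
apply/orbit_projP.
have /orbit_projP[t tx] : orbit_proj (orbit_repr (orbit_proj x)) = orbit_proj x.
  exact: orbit_reprK.
by exists t; rewrite -b_comm tx.
Qed.

Lemma orbit_act1 y : orbit_act 1 y = y.
Proof. by rewrite -[y]orbit_reprK orbit_act_proj b1. Qed.

Lemma orbit_actM g h y : orbit_act (g * h) y = orbit_act g (orbit_act h y).
Proof. by rewrite -[y]orbit_reprK !orbit_act_proj bM. Qed.

Lemma orbit_act_continuous :
  continuous (fun p : discrete_topology A * orbit_space a =>
    orbit_act p.1 p.2).
Proof.
have cg g : continuous (orbit_act g).
  apply: orbit_space_continuous.
  rewrite (_ : _ \o _ = orbit_proj \o b g); last first.
    by apply/funext => z; exact: orbit_act_proj.
  move=> x; apply: continuous_comp; first exact: b_continuous.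
  exact: orbit_proj_continuous.
(* As [[set g]] is open in the discrete group, continuity in [y] for fixed [g] is enough. *)
move=> [g y] U /= Uy; exists ([set g], orbit_act g @^-1` U).
  by split; [exact/principal_filterP | exact: cg].
by move=> [h z] /= [-> ].
Qed.

Definition orbit_action :
    continuous_action (discrete_topology A) (orbit_space a) :=
  ContinuousAction orbit_act1 orbit_actM orbit_act_continuous.

Lemma orbit_actionE g x : orbit_action g (orbit_proj x) = orbit_proj (b g x).
Proof. exact: orbit_act_proj. Qed.

End CommutingAction.
End OrbitProjection.

(** * Roots in [C] and the phase map in one coordinate *)

Section Twist.
Local Open Scope classical_set_scope.
Local Open Scope ring_scope.
Variable C : numClosedFieldType.

(** In characteristic zero ['X^n - 1] is separable, so it has [n] distinct roots, and [n] distinct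
    [n]-th roots of unity include a primitive one. *)
Lemma prim_root_exists n : (0 < n)%N -> {z : C | n.-primitive_root z}.
Proof.
move=> n_gt0; apply/cid; pose p : {poly C} := 'X^n - 1.
have [r Dp] := closed_field_poly_normal p.
rewrite (monicP _) ?monicXnsubC // scale1r in Dp.
have rn1 : all n.-unity_root r by apply/allP=> z; rewrite -root_prod_XsubC -Dp.
have sz_r : (n < (size r).+1)%N.
  by rewrite -(size_prod_XsubC r id) -Dp size_XnsubC.
have [|z] := hasP (has_prim_root n_gt0 rn1 _ sz_r); last by exists z.
by rewrite -separable_prod_XsubC -Dp separable_Xn_sub_1 // pnatr_eq0 -lt0n.
Qed.

(* The distances from [z] to the [m] roots of ['X^m - a] multiply up to
   [`|z ^+ m - a|], so the smallest one is at most its [m]-th root. *)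
Lemma root_near m (a z : C) : (0 < m)%N ->
  exists2 r, r ^+ m = a & `|z - r| ^+ m <= `|z ^+ m - a|.
Proof.
move=> m_gt0; have [rs Drs] := closed_field_poly_normal ('X^m - a%:P).
rewrite (monicP _) ?monicXnsubC // scale1r in Drs.
have sz_rs : size rs = m.
  by apply: succn_inj; rewrite -(size_prod_XsubC rs id) -Drs size_XnsubC.
have rsP r : r \in rs -> r ^+ m = a.
  by rewrite -root_prod_XsubC -Drs rootE !hornerE subr_eq0 => /eqP.
have Dnorm : `|z ^+ m - a| = \prod_(r <- rs) `|z - r|.
  rewrite -normr_prod; congr (`|_|).
  have -> : z ^+ m - a = ('X^m - a%:P).[z] by rewrite !hornerE.
  by rewrite Drs horner_prod; apply: eq_bigr => r _; rewrite !hornerE.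
have [/hasP[r /rsP ra le_r]|/hasPn far] :=
  boolP (has (fun r => `|z - r| ^+ m <= `|z ^+ m - a|) rs); first by exists r.
(* If every root were too far, this strict inequality would hold; but both products equal the [m]-th
   power of [|z ^+ m - a|]. *)
suff : \prod_(r <- rs) `|z ^+ m - a| < \prod_(r <- rs) `|z - r| ^+ m.
  rewrite prodrXl -Dnorm big_const_seq count_predT sz_rs.
  by rewrite -Monoid.iteropE ltxx.
rewrite big_seq [ltRHS]big_seq; apply: ltr_prod => [|r /far].
  by apply/hasP; case: rs sz_rs {Drs rsP Dnorm far} => [m0|r rs _];
    [rewrite -m0 in m_gt0 | exists r; rewrite !mem_head].
by rewrite -real_ltNge ?realX ?normr_real // => ->; rewrite normr_ge0.
Qed.

(* [r * u] with [0 <= r] and [`|u| = 1] goes to [r * u ^+ m]; at [0] and for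
   [1 < m] this relies on [0 / 0 = 0]. *)
Definition twist m (z : C) : C := z ^+ m / `|z| ^+ m.-1.

Lemma twist0 m : (0 < m)%N -> twist m 0 = 0.
Proof. by case: m => // m _; rewrite /twist exprS !mul0r. Qed.

Lemma norm_twist m z : (0 < m)%N -> `|twist m z| = `|z|.
Proof.
case: m => // m _; have [->|z0] := eqVneq z 0.
  by rewrite twist0 // normr0.
rewrite /twist normrM normfV !normrX normr_id exprS mulfK //.
by rewrite expf_neq0 // normr_eq0.
Qed.

Lemma twistM m t z : `|t| = 1 -> twist m (t * z) = t ^+ m * twist m z.
Proof. by move=> t1; rewrite /twist normrM t1 mul1r exprMn mulrA. Qed.

(** Since the modulus is kept, the denominator of [twist] can be read off from its value. With the
    converse [twist_root], solving [twist m r = w] becomes extracting an [m]-th root. *)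
Lemma twistK m z : (0 < m)%N -> z ^+ m = twist m z * `|twist m z| ^+ m.-1.
Proof.
move=> m_gt0; have [->|z0] := eqVneq z 0.
  by rewrite twist0 // mul0r expr0n; case: m m_gt0.
by rewrite norm_twist // /twist divfK // expf_neq0 // normr_eq0.
Qed.

Lemma twist_root m r w :
  (0 < m)%N -> r ^+ m = w * `|w| ^+ m.-1 -> twist m r = w.
Proof.
move=> m_gt0 rw; have norm_r : `|r| = `|w|.
  apply/eqP; rewrite -(eqrXn2 m_gt0) // -normrX rw normrM normrX normr_id.
  by rewrite -exprS prednK.
have [w0|w0] := eqVneq w 0.
  move: norm_r; rewrite w0 normr0 => /eqP; rewrite normr_eq0 => /eqP ->.
  exact: twist0.
by rewrite /twist rw norm_r mulfK // expf_neq0 // normr_eq0.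
Qed.

Lemma twist_eq m z w : (0 < m)%N -> twist m z = twist m w ->
  exists2 t, t ^+ m = 1 & w = t * z.
Proof.
move=> m_gt0 zw; have zwm : w ^+ m = z ^+ m.
  by rewrite [LHS]twistK // [RHS]twistK // zw.
have [z0|z0] := eqVneq z 0.
  exists 1; first exact: expr1n.
  apply/eqP; rewrite z0 mulr0 -normr_eq0 -(norm_twist w m_gt0) -zw.
  by rewrite norm_twist // z0 normr0.
exists (w / z); last by rewrite divfK.
by rewrite expr_div_n zwm divff // expf_neq0.
Qed.

Lemma cvgX (T : topologicalType) (F : set_system T) (FF : Filter F)
    (f : T -> C) (l : C) k :
  f x @[x --> F] --> l -> f x ^+ k @[x --> F] --> l ^+ k.
Proof.
move=> fl; elim: k => [|k IHk]; first exact: cvg_cst.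
by under eq_fun do rewrite exprS; rewrite exprS; apply: cvgM.
Qed.

Lemma twist_continuous m : (0 < m)%N -> continuous (twist m).
Proof.
move=> m_gt0 z; have [->|z0] := eqVneq z 0.
  rewrite /continuous_at twist0 //.
  (* At [0] the quotient gives no continuity; preservation of the modulus does. *)
  apply/(@cvgr0Pnorm_lt _ C^o _ (nbhs (0 : C))) => e e0.
  by apply: filterS (@nbhs0_lt _ C^o _ e0) => w; rewrite norm_twist.
apply: (@cvgM _ _ (nbhs z)); first by apply: (@cvgX _ (nbhs z)); exact: cvg_id.
apply: (@cvgV _ _ (nbhs z)); first by rewrite expf_neq0 // normr_eq0.
by apply: (@cvgX _ (nbhs z)); exact: norm_continuous.
Qed.

(** Openness at [z]: as [w] tends to [twist m z], the number [w * |w| ^+ m.-1] tends to [z ^+ m], so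
    by [root_near] it has an [m]-th root close to [z]. *)
Lemma twist_open m z (e : C) : (0 < m)%N -> 0 < e ->
  \forall w \near twist m z, exists r, twist m r = w /\ `|z - r| < e.
Proof.
move=> m_gt0 e_gt0.
have cvg_pow : w * `|w| ^+ m.-1 @[w --> twist m z] --> z ^+ m.
  rewrite twistK //; apply: (@cvgM _ _ (nbhs (twist m z))); first exact: cvg_id.
  by apply: (@cvgX _ (nbhs (twist m z))); exact: norm_continuous.
near=> w; have [r rw r_near] := root_near (w * `|w| ^+ m.-1) z m_gt0.
exists r; split; first exact: twist_root.
rewrite -(ltr_pXn2r m_gt0) ?nnegrE ?normr_ge0 ?(ltW e_gt0) //.
apply: le_lt_trans r_near _.
near: w; apply: (@cvgr_dist_lt _ C^o _ (nbhs (twist m z)) _ _ _ cvg_pow).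
exact: exprn_gt0.
Unshelve. all: by end_near. Qed.

End Twist.

(** * The phase map on the sphere *)

Section SphereTwist.
Local Open Scope classical_set_scope.
Local Open Scope ring_scope.
Variables (C : numClosedFieldType) (n : nat).

Lemma continuous_to_sphere (X : topologicalType) (f : X -> sphere C n) :
  (forall i, continuous (fun x => sphere_val (f x) 0 i)) -> continuous f.
Proof.
move=> cf; apply: to_sphere_continuous => x A [P Px PA].
suff : \forall y \near x, forall i j, P i j (sphere_val (f y) i j).
  by apply: filterS => y Py; exact: PA.
apply: (@filter_forall _ _ _ (nbhs x)) => i.
apply: (@filter_forall _ _ _ (nbhs x)) => j.
rewrite (ord1 i); exact: (cf j x _ (Px 0 j)).
Qed.

Lemma sphere_coord_continuous i :
  continuous (fun z : sphere C n => sphere_val z 0 i).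
Proof.
move=> z; exact: (cvg_comp _ _ (@sphere_val_continuous C n z)
  (@coord_continuous _ _ _ _ _ _)).
Qed.

Lemma nbhs_sphere (z : sphere C n) (V : set (sphere C n)) : nbhs z V ->
  exists2 e : C, 0 < e & forall w : sphere C n,
    (forall i, `|sphere_val z 0 i - sphere_val w 0 i| < e) -> V w.
Proof.
rewrite nbhsE => -[_ [[U U_open <-] zU] UV].
have /nbhs_ballP[e e_gt0 eU] : nbhs (sphere_val z) U by exact: open_nbhs_nbhs.
exists e => // w zw; apply: UV; apply: eU; split=> // i j.
by rewrite (ord1 i); exact: zw.
Qed.

Lemma circle_valX (t : circle C) N : circle_val (t ^+ N)%g = circle_val t ^+ N.
Proof. by elim: N => [|N IHN] //; rewrite expgS exprS -IHN. Qed.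

Lemma weighted_actionE (chi : 'I_n.+1 -> nat) t z i :
  sphere_val (weighted_action C chi t z) 0 i =
  circle_val t ^+ chi i * sphere_val z 0 i.
Proof. exact: mxE. Qed.

Section CoordinatewiseMaps.
Variable f : 'I_n.+1 -> C -> C.
Hypothesis norm_f : forall i z, `|f i z| = `|z|.

Definition row_map (z : 'rV[C]_n.+1) : 'rV[C]_n.+1 := \row_i f i (z 0 i).

Lemma row_map_sphere (z : sphere C n) :
  @unit_sphere C n (row_map (sphere_val z)).
Proof.
rewrite /unit_sphere /= -[RHS](sphere_valP z).
by apply: eq_bigr => i _; rewrite mxE norm_f.
Qed.

Definition sphere_map (z : sphere C n) : sphere C n := Sphere (row_map_sphere z).

Lemma sphere_mapE z i : sphere_val (sphere_map z) 0 i = f i (sphere_val z 0 i).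
Proof. exact: mxE. Qed.

Lemma sphere_map_continuous :
  (forall i, continuous (f i)) -> continuous sphere_map.
Proof.
move=> cf; apply: continuous_to_sphere => i z.
rewrite (_ : (fun _ => _) = f i \o (fun z : sphere C n => sphere_val z 0 i)).
  apply: continuous_comp; [exact: sphere_coord_continuous | exact: cf].
by apply/funext => w; exact: sphere_mapE.
Qed.

End CoordinatewiseMaps.

Section TwistMap.
Variable m : 'I_n.+1 -> nat.
Hypothesis m_gt0 : forall i, (0 < m i)%N.

Definition sphere_twist : sphere C n -> sphere C n :=
  @sphere_map (fun i => twist (m i)) (fun i z => norm_twist z (m_gt0 i)).

(** Coordinatewise preimages lie on the sphere automatically, because [twist] keeps moduli. *)
Lemma sphere_twist_root (w : sphere C n) (r : 'I_n.+1 -> C) :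
  (forall i, twist (m i) (r i) = sphere_val w 0 i) ->
  exists2 z, sphere_twist z = w & forall i, sphere_val z 0 i = r i.
Proof.
move=> rw.
have r_sphere : @unit_sphere C n (\row_i r i).
  rewrite /unit_sphere /= -[RHS](sphere_valP w); apply: eq_bigr => i _.
  by rewrite mxE -rw norm_twist.
exists (Sphere r_sphere) => [|i]; last exact: mxE.
by apply: sphere_val_inj; apply/rowP => i; rewrite sphere_mapE mxE -rw.
Qed.

Lemma sphere_twist_surj w : exists z, sphere_twist z = w.
Proof.
have root_exists i : exists r, twist (m i) r = sphere_val w 0 i.
  have [r rw _] := root_near
    (sphere_val w 0 i * `|sphere_val w 0 i| ^+ (m i).-1) 0 (m_gt0 i).
  by exists r; exact: twist_root.
by have [r /sphere_twist_root[z zw _]] := choice root_exists; exists z.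
Qed.

Lemma sphere_twist_continuous : continuous sphere_twist.
Proof. by apply: sphere_map_continuous => i; exact: twist_continuous. Qed.

Lemma sphere_twist_quotient_map : quotient_map sphere_twist.
Proof.
split=> [|B]; first exact: sphere_twist_surj.
split=> [B_open|]; last by move: B; exact/continuousP/sphere_twist_continuous.
rewrite openE => w Bw; have [z zw] := sphere_twist_surj w.
have [|e e_gt0 zB] := @nbhs_sphere z (sphere_twist @^-1` B).
  by apply: open_nbhs_nbhs; split=> //=; rewrite zw.
(* Openness is checked one coordinate at a time; the finitely many neighbourhoods are intersected,
   and the roots found are assembled into a preimage near [z]. *)
have : \forall w' \near w, forall i, exists r,
    twist (m i) r = sphere_val w' 0 i /\ `|sphere_val z 0 i - r| < e.
  apply: (@filter_forall _ _ _ (nbhs w)) => i.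
  apply: (@sphere_coord_continuous i w (fun u => exists r,
    twist (m i) r = u /\ `|sphere_val z 0 i - r| < e)).
  by rewrite -zw sphere_mapE; exact: twist_open.
apply: filterS => w' near_roots.
have [r rP] := choice near_roots.
have [z' <- z'r] := sphere_twist_root (fun i => (rP i).1).
by apply: zB => i; rewrite z'r; exact: (rP i).2.
Qed.

Lemma sphere_twist_eq z w : sphere_twist z = sphere_twist w ->
  exists t : 'I_n.+1 -> C, forall i,
    t i ^+ m i = 1 /\ sphere_val w 0 i = t i * sphere_val z 0 i.
Proof.
move=> zw; suff /choice[t tP] : forall i, exists t,
  t ^+ m i = 1 /\ sphere_val w 0 i = t * sphere_val z 0 i by exists t.
move=> i.
have := congr1 (fun u => sphere_val u 0 i) zw.
rewrite /sphere_twist !sphere_mapE.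
by move=> /(twist_eq (m_gt0 i))[t]; exists t.
Qed.

(** In coordinate [i] the two sides carry the factors [t ^+ (omega i * m i)] and
    [t ^+ (N * chi i)]. *)
Lemma sphere_twist_equivariant (chi omega : 'I_n.+1 -> nat) N (t : circle C) z :
  (forall i, omega i * m i = N * chi i)%N ->
  sphere_twist (weighted_action C omega t z) =
  weighted_action C chi (t ^+ N)%g (sphere_twist z).
Proof.
move=> mE; apply: sphere_val_inj; apply/rowP => i.
rewrite sphere_mapE !weighted_actionE sphere_mapE twistM; last first.
  by rewrite normrX norm_circle_val expr1n.
by rewrite circle_valX -!exprM mE.
Qed.

End TwistMap.

Lemma circle_root N (s : circle C) : (0 < N)%N -> exists t, (t ^+ N)%g = s.
Proof.
move=> N_gt0; have [r rs _] := root_near (circle_val s) 0 N_gt0.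
have r1 : unit_circle r.
  apply/eqP; rewrite -(@pexpr_eq1 _ _ N) // -normrX rs.
  exact/eqP/norm_circle_val.
by exists (Circle r1); apply: circle_val_inj; rewrite circle_valX.
Qed.

End SphereTwist.

(** * The finite group of roots of unity and the fibres of the phase map *)

Section RootsOfUnityAction.
Local Open Scope classical_set_scope.
Local Open Scope ring_scope.
Variables (C : numClosedFieldType) (n : nat) (m : 'I_n.+1 -> nat).
Hypothesis m_gt0 : forall i, (0 < m i)%N.

(* [(Z/M)^(n+1)] with [M] the product of the [m i] is used instead of the
   product of the groups [mu_(m i)]; it acts through the surjection given by
   [g i |-> zeta i ^+ g i]. *)
Definition roots_group : finGroupType := 'rV['I_(\prod_i m i).-1.+1]_n.+1.

Definition zeta i : C := sval (prim_root_exists C (m_gt0 i)).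

Lemma zeta_prim i : (m i).-primitive_root (zeta i).
Proof. exact: (svalP (prim_root_exists C (m_gt0 i))). Qed.

(** The order [m i] of [zeta i] divides the modulus; this makes addition in [roots_group] compatible
    with the action. *)
Lemma zetaX_mod i k : zeta i ^+ (k %% (\prod_i m i).-1.+1) = zeta i ^+ k.
Proof.
apply: expr_mod; rewrite prednK ?prodn_gt0 //.
by rewrite (bigD1 i) //= exprM (prim_expr_order (zeta_prim i)) expr1n.
Qed.

Lemma norm_zeta_mul (g : roots_group) i (z : C) : `|zeta i ^+ g 0 i * z| = `|z|.
Proof.
suff z1 : `|zeta i| = 1 by rewrite normrM normrX z1 expr1n mul1r.
apply/eqP; rewrite -(@pexpr_eq1 _ _ (m i)) // -normrX.
by rewrite (prim_expr_order (zeta_prim i)) normr1.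
Qed.

Definition roots_act (g : roots_group) : sphere C n -> sphere C n :=
  sphere_map (norm_zeta_mul g).

Lemma roots_actE g z i :
  sphere_val (roots_act g z) 0 i = zeta i ^+ g 0 i * sphere_val z 0 i.
Proof. exact: sphere_mapE. Qed.

Lemma roots_act1 z : roots_act 1%g z = z.
Proof.
by apply: sphere_val_inj; apply/rowP => i; rewrite roots_actE mxE expr0 mul1r.
Qed.

Lemma roots_actM g h z : roots_act (g * h)%g z = roots_act g (roots_act h z).
Proof.
apply: sphere_val_inj; apply/rowP => i; rewrite !roots_actE mulrA -exprD.
by rewrite mxE zetaX_mod.
Qed.

Lemma roots_act_continuous g : continuous (roots_act g).
Proof.
apply: sphere_map_continuous => i z.
apply: (@cvgM _ _ (nbhs z)); [exact: cvg_cst | exact: cvg_id].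
Qed.

Lemma roots_act_weighted omega g t z :
  roots_act g (weighted_action C omega t z) =
  weighted_action C omega t (roots_act g z).
Proof.
apply: sphere_val_inj; apply/rowP => i.
by rewrite !(roots_actE, weighted_actionE) mulrCA.
Qed.

Lemma sphere_twistP (z w : sphere C n) :
  sphere_twist m_gt0 z = sphere_twist m_gt0 w <-> exists g, roots_act g z = w.
Proof.
split=> [/sphere_twist_eq[t tP]|[g <-]]; last first.
  apply: sphere_val_inj; apply/rowP => i; rewrite !sphere_mapE.
  rewrite twistM.
    by rewrite exprAC (prim_expr_order (zeta_prim i)) expr1n mul1r.
  by have := norm_zeta_mul g i 1; rewrite mulr1 normr1.
(* The ratios [t i] are [m i]-th roots of unity, hence powers of [zeta i]; reducing their exponents
   gives the group element. *)
have /choice[k kP] i : exists k, t i = zeta i ^+ k.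
  by have [k ->] := prim_rootP (zeta_prim i) (tP i).1; exists k.
exists (\row_i inZp (k i)); apply: sphere_val_inj; apply/rowP => i.
by rewrite roots_actE mxE (tP i).2 kP zetaX_mod.
Qed.

End RootsOfUnityAction.

(** * Comparison of the two composite quotient maps *)

Section OrbitSpacesOfWeightedProjectiveSpaces.
Local Open Scope ring_scope.

Theorem weighted_projective_space_orbits (C : numClosedFieldType) (n : nat)
    (chi omega : 'I_n.+1 -> nat) :
  (forall i, 0 < chi i)%N -> (forall i, 0 < omega i)%N ->
  exists (A : finGroupType)
         (a : continuous_action (discrete_topology A)
                (weighted_projective_space C omega)),
    abelian [set: A]%G /\
    homeomorphic (orbit_space a) (weighted_projective_space C chi).
Proof.
move=> chi_gt0 omega_gt0.
pose N := (\prod_i omega i)%N.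
(* This is [N * chi i / omega i], written without division. *)
pose m i := (chi i * \prod_(j | j != i) omega j)%N.
have m_gt0 i : (0 < m i)%N by rewrite muln_gt0 chi_gt0 prodn_cond_gt0.
have N_gt0 : (0 < N)%N by rewrite prodn_gt0.
have mE i : (omega i * m i = N * chi i)%N.
  by rewrite /N (bigD1 i) //= mulnCA mulnC.
pose a := orbit_action (@roots_act1 _ _ m m_gt0) (@roots_actM _ _ m m_gt0)
  (@roots_act_continuous _ _ m m_gt0) (@roots_act_weighted C _ m m_gt0 omega).
exists (roots_group m), a; split; first exact: FinRing.zmod_abelian.
have homeo := (quotient_map_homeomorphic
  (quotient_map_comp (orbit_proj_quotient_map _) (orbit_proj_quotient_map a))
  (quotient_map_comp (sphere_twist_quotient_map C m_gt0)
    (orbit_proj_quotient_map (weighted_action _ chi)))).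
apply: homeo => z w /=; split.
(* Here [w] is [z] moved by [g] and then by [t]: the phase map absorbs [g] and turns [t] into
   [t ^+ N]. *)
- move=> /(orbit_projP a)[g]; rewrite orbit_actionE.
  move=> /(orbit_projP (weighted_action C omega))[t <-].
  apply/(orbit_projP (weighted_action C chi)); exists (t ^+ N)%g.
  rewrite (sphere_twist_equivariant m_gt0 _ _ mE).
  congr (weighted_action _ _ _ _).
  by apply/(sphere_twistP m_gt0); exists g.
(* Conversely, an [N]-th root [t] of [s] puts [w] and the [omega]-translate of [z] by [t] in one
   fibre of the phase map, that is, in one orbit of [roots_act]. *)
- move=> /(orbit_projP (weighted_action C chi))[s].
  have [t <-] := circle_root s N_gt0.
  rewrite -(sphere_twist_equivariant m_gt0 _ _ mE).
  move=> /(sphere_twistP m_gt0)[g <-].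
  apply/(orbit_projP a); exists g; rewrite orbit_actionE roots_act_weighted.
  by apply/(orbit_projP (weighted_action C omega)); exists t.
Qed.

End OrbitSpacesOfWeightedProjectiveSpaces.

Theorem corollary3p14 (R : realType) (n : nat) (chi omega : 'I_n.+1 -> nat)
    (chi_gt0 : forall i, (0 < chi i)%N) (omega_gt0 : forall i, (0 < omega i)%N) :
  exists (A : finGroupType)
         (a : continuous_action (discrete_topology A)
                (weighted_projective_space R[i]%C omega)),
    abelian [set: A]%G /\
    homeomorphic (orbit_space a) (weighted_projective_space R[i]%C chi).
Proof. exact: weighted_projective_space_orbits. Qed.
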